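(* Let $\mathbf A$ be a totally ordered Dunn monoid that is generated (as an RL) by a set $X$ of idempotent elements. Then $\mathbf A$ is idempotent.
   Context: A (commutative) residuated lattice (RL) is an algebra $\langle A;\cdot,\to,\wedge,\vee,e\rangle$ such that $\langle A;\cdot,e\rangle$ is a commutative monoid, $\langle A;\wedge,\vee\rangle$ is a lattice, and $x\cdot y\leqslant z \iff y\leqslant x\to z$. A Dunn monoid is an RL whose lattice reduct is distributive and which satisfies $x\leqslant x\cdot x$. An element $a$ is idempotent if $a\cdot a=a$; the algebra is idempotent if all its elements are. *)

(* Defs.v *)
From HB Require Import structures.
From mathcomp Require Import all_boot all_order.
From mathcomp Require Import boolp classical_sets.

Set Implicit Arguments.
Unset Strict Implicit.
Unset Printing Implicit Defensive.

Local Open Scope order_scope.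
Local Open Scope group_scope.

HB.mixin Record Lattice_Monoid_isResiduatedLattice d T
    of Order.Lattice d T & Monoid T := {
  rl_imp : T -> T -> T;
  rl_mulC : commutative (@mul T);
  rl_residuation : forall x y z : T, (x * y <= z) = (y <= rl_imp x z)
}.

#[short(type="residuatedLatticeType")]
HB.structure Definition ResiduatedLattice d :=
  {T of Order.Lattice d T & Monoid T
      & Lattice_Monoid_isResiduatedLattice d T}.

HB.mixin Record ResiduatedLattice_isSquareIncreasing d T
    of ResiduatedLattice d T := {
  rl_le_sqr : forall x : T, x <= x * x
}.

#[short(type="dunnMonoidType")]
HB.structure Definition DunnMonoid d :=
  {T of Order.DistrLattice d T & ResiduatedLattice d T
      & ResiduatedLattice_isSquareIncreasing d T}.

Definition idempotent_elt (T : magmaType) (x : T) : Prop := x * x = x.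

Definition idempotent_alg (T : magmaType) : Prop :=
  forall x : T, idempotent_elt x.

Definition rl_subuniverse (d : Order.disp_t) (A : residuatedLatticeType d)
    (S : set A) : Prop :=
  [/\ S 1,
      (forall x y, S x -> S y -> S (x * y)),
      (forall x y, S x -> S y -> S (rl_imp x y)),
      (forall x y, S x -> S y -> S (x `&` y))
    & (forall x y, S x -> S y -> S (x `|` y))].

Definition rl_generated_by (d : Order.disp_t) (A : residuatedLatticeType d)
    (X : set A) : Prop :=
  smallest (@rl_subuniverse d A) X = [set: A]%classic.

(* Main.v *)
Require Import Defs.
From HB Require Import structures.
From mathcomp Require Import all_boot all_order.
From mathcomp Require Import boolp classical_sets.

(** The idempotent elements form a subuniverse. The only interesting case is
    residuation: if [a] and [b] are idempotent and [c = a -> b], then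
    [a c c = (a c) (a c) <= b b = b], so [c c <= c]. *)

Import Order.LTheory.
Local Open Scope order_scope.
Local Open Scope group_scope.

(** By residuation the claim becomes [y <= rl_imp x (x * z)], and [z] already lies below that
    residual. *)
Lemma rl_mul_le2l d (A : residuatedLatticeType d) (x y z : A) :
  y <= z -> x * y <= x * z.
Proof. by move=> yz; rewrite rl_residuation (le_trans yz) // -rl_residuation. Qed.

Lemma rl_mul_le2 d (A : residuatedLatticeType d) (x y z t : A) :
  x <= y -> z <= t -> x * z <= y * t.
Proof.
move=> xy zt; apply: (@le_trans _ _ (x * t)); first exact: rl_mul_le2l.
by rewrite (rl_mulC x) (rl_mulC y) rl_mul_le2l.
Qed.

Lemma rl_mul_imp_le d (A : residuatedLatticeType d) (x y : A) :
  x * rl_imp x y <= y.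
Proof. by rewrite rl_residuation. Qed.

Lemma rl_mulACA d (A : residuatedLatticeType d) (x y z t : A) :
  (x * y) * (z * t) = (x * z) * (y * t).
Proof. by rewrite -!mulgA (mulgA y) (rl_mulC y) -mulgA. Qed.

Lemma idempotent_mul d (A : residuatedLatticeType d) (x y : A) :
  idempotent_elt x -> idempotent_elt y -> idempotent_elt (x * y).
Proof. by rewrite /idempotent_elt => xx yy; rewrite rl_mulACA xx yy. Qed.

Lemma idempotent_imp d (A : dunnMonoidType d) (x y : A) :
  idempotent_elt x -> idempotent_elt y -> idempotent_elt (rl_imp x y).
Proof.
(* The square-increasing law gives one inequality; only [c * c <= c] with [c = rl_imp x y] is
   left. *)
rewrite /idempotent_elt => xx yy; apply: le_anti; rewrite rl_le_sqr andbT.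
by rewrite -rl_residuation -{1}xx rl_mulACA -[leRHS]yy rl_mul_le2 ?rl_mul_imp_le.
Qed.

Lemma idempotent_subuniverse d (A : dunnMonoidType d) :
  total (<=%O : rel A) -> rl_subuniverse (@idempotent_elt A : set A).
Proof.
move=> A_total; split.
- exact: mulg1.
- exact: idempotent_mul.
- exact: idempotent_imp.
(* Totality enters here: in a chain, a meet or a join is one of its two arguments. *)
- by move=> x y xx yy; case/orP: (A_total x y) => [/meet_l|/meet_r] ->.
- by move=> x y xx yy; case/orP: (A_total x y) => [/join_r|/join_l] ->.
Qed.

Theorem theorem6p16 (d : Order.disp_t) (A : dunnMonoidType d)
    (A_total : total (<=%O : rel A))
    (X : set A) (X_idem : forall x : A, X x -> idempotent_elt x)
    (X_gen : rl_generated_by X) :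
  idempotent_alg A.
Proof.
move=> x.
have : smallest (@rl_subuniverse d A) X x by rewrite X_gen.
(* [smallest] is an intersection, so [x] lies in every subuniverse containing [X], in particular in
   the set of idempotents. *)
by apply; split; [exact: idempotent_subuniverse|exact: X_idem].
Qed.
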